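(* Fix a choice of sign and let $m=(-2\pm i)^k$ with $k\in\mathbb{N}$, $k\geq1$. Then there exists a Gaussian integer $a$ with $\gcd(a,m)=1$ and $a/m\in\mathfrak{F}$ such that $K_{\mathbb{C}}(a/m)\leq 3\sqrt{2}$.
   Context: $\mathfrak{F}=\{z\in\mathbb{C}: -\tfrac12\leq\mathrm{Re}(z)<\tfrac12,\ -\tfrac12\leq\mathrm{Im}(z)<\tfrac12\}$. For $z\in\mathbb{C}$, $[z]:=\lfloor \mathrm{Re}(z)+\tfrac12\rfloor+i\lfloor \mathrm{Im}(z)+\tfrac12\rfloor$. The complex Gauss map $T:\mathfrak{F}\to\mathfrak{F}$ is $T(z)=z^{-1}-[z^{-1}]$ for $z\neq0$, $T(0)=0$. For $z\in\mathfrak{F}\setminus\{0\}$, $a_1(z)=[z^{-1}]$ and, while $T^{n-1}(z)\neq0$, $a_n(z)=a_1(T^{n-1}(z))$; for $z\in\mathbb{Q}(i)\cap\mathfrak{F}$ this process terminates, giving the Hurwitz continued fraction $z=[a_1(z),\ldots,a_n(z)]_{\mathbb{C}}$. Define $K_{\mathbb{C}}(z)=\max(|a_1(z)|,\ldots,|a_n(z)|)$. *)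

(* Defs.v *)
From mathcomp Require Import all_boot all_order all_algebra.
From mathcomp Require Import boolp reals.
From mathcomp Require Export complex.
From mathcomp Require Import ring lra.

Set Implicit Arguments.
Unset Strict Implicit.
Unset Printing Implicit Defensive.

Import Order.TTheory GRing.Theory Num.Theory.

Local Open Scope ring_scope.
Local Open Scope complex_scope.

(* The usual complex numbers are R[i] for R : realType. The library's `|z| is
   valued in R[i]; this is the same modulus, valued in R. *)
Notation cabs := ComplexField.Normc.normc.

(* The R-valued projections, not those of numClosedFieldType. *)
Local Notation Re := complex.Re.
Local Notation Im := complex.Im.

Section Hurwitz.
Variable R : realType.
Implicit Types (z a b d g : R[i]) (n : nat).

Definition gauss_int z : bool := (Re z \is a Num.int) && (Im z \is a Num.int).

Definition gauss_dvd d z : Prop :=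
  exists2 q : R[i], gauss_int q & z = d * q.

(* g is a gcd of a and b in Z[i] (unique up to units). *)
Definition gauss_is_gcd a b g : Prop :=
  [/\ gauss_int g, gauss_dvd g a, gauss_dvd g b
    & forall d, gauss_int d -> gauss_dvd d a -> gauss_dvd d b -> gauss_dvd d g].

Definition fundamental_domain z : bool :=
  (- 2^-1 <= Re z < 2^-1) && (- 2^-1 <= Im z < 2^-1).

Definition gauss_round z : R[i] :=
  (Num.floor (Re z + 2^-1))%:~R +i* (Num.floor (Im z + 2^-1))%:~R.

Definition gauss_map z : R[i] :=
  if z == 0 then 0 else z^-1 - gauss_round z^-1.

(* a_n(z), indexed from n = 1; meaningful when T^(n-1)(z) != 0. *)
Definition hcf_digit n z : R[i] := gauss_round (iter n.-1 gauss_map z)^-1.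

(* The number of digits: the least n with T^n(z) = 0. The default 0 is never
   used on Q(i), by [gauss_map_terminates] below. *)
Definition hcf_length z : nat :=
  if pselect (exists n, iter n gauss_map z == 0) is left e then ex_minn e
  else 0%N.

Definition hcf_K z : R :=
  \big[Num.max/0]_(1 <= n < (hcf_length z).+1) cabs (hcf_digit n z).

Lemma gauss_map_domain z : fundamental_domain (gauss_map z).
Proof.
rewrite /gauss_map; case: eqP => _.
  by rewrite /fundamental_domain /=; apply/andP; split; apply/andP; split; lra.
move: (z^-1) => w; case: w => x y; rewrite /fundamental_domain /gauss_round /=.
have hx := Num.Theory.floor_itv (x + 2^-1).
have hy := Num.Theory.floor_itv (y + 2^-1).
move: hx hy; rewrite !intrD.
by move=> /andP[h1 h2] /andP[h3 h4]; apply/andP; split; apply/andP; split; lra.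
Qed.

Let nsq z : R := Re z ^+ 2 + Im z ^+ 2.

Lemma gauss_map_terminates a b : gauss_int a -> gauss_int b ->
  exists n, iter n gauss_map (a / b) == 0.
Proof.
have nsqM x y : nsq (x * y) = nsq x * nsq y.
  by case: x => x1 x2; case: y => y1 y2; rewrite /nsq /=; ring.
have giM x y : gauss_int x -> gauss_int y -> gauss_int (x * y).
  case: x => x1 x2; case: y => y1 y2 /andP[/= h1 h2] /andP[/= h3 h4].
  by apply/andP; split=> /=; rewrite ?rpredB ?rpredD ?rpredM.
have giB x y : gauss_int x -> gauss_int y -> gauss_int (x - y).
  case: x => x1 x2; case: y => y1 y2 /andP[/= h1 h2] /andP[/= h3 h4].
  by apply/andP; split=> /=; rewrite rpredB.
have gir x : gauss_int (gauss_round x) by rewrite /gauss_int /= !intr_int.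
have nat_nsq x : gauss_int x -> exists n : nat, nsq x = n%:R.
  case/andP=> h1 h2; apply/natrP; rewrite natrEint /nsq.
  by rewrite rpredD ?rpredX // addr_ge0 ?sqr_ge0.
have small z : nsq (gauss_map z) <= 2^-1.
  have /andP[/andP[h1 h2] /andP[h3 h4]] := gauss_map_domain z.
  by rewrite /nsq; nra.
have nsq0 x : nsq x = 0 -> x = 0.
  case: x => x y; rewrite /nsq /= => h.
  have x0 : x = 0 by nra.
  have y0 : y = 0 by nra.
  by rewrite x0 y0.
move=> ga gb; have [n en] := nat_nsq a ga.
elim/ltn_ind: n a b ga gb en => n IH a b ga gb en.
have [->|a0] := eqVneq a 0; first by exists 0%N; rewrite /= mul0r.
have [->|b0] := eqVneq b 0; first by exists 0%N; rewrite /= invr0 mulr0.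
have ab0 : a / b != 0 by rewrite mulf_neq0 ?invr_eq0.
pose r := b - a * gauss_round (a / b)^-1.
have gr : gauss_int r by apply: giB => //; apply: giM.
have eT : gauss_map (a / b) = r / a.
  by rewrite /gauss_map (negbTE ab0) /r mulrBl mulrAC divff // mul1r invf_div.
have [p ep] := nat_nsq r gr.
have er : r = a * gauss_map (a / b) by rewrite eT mulrC divfK.
have n0 : (0 : R) < n%:R.
  rewrite ltr0n lt0n; apply: contra_neq a0 => n0.
  by apply: nsq0; rewrite en n0.
have ltpn : (p < n)%N.
  rewrite -(ltr_nat R) -ep er nsqM en.
  have := small (a / b); nra.
have [q hq] := IH p ltpn r a gr ga ep.
by exists q.+1; rewrite iterSr eT.
Qed.

End Hurwitz.

(* Main.v *)
Require Import Defs.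
From mathcomp Require Import all_boot all_order all_algebra reals.
From mathcomp Require Import boolp ring lra zify.

(** A word of Gaussian integers of norm 5 or between 9 and 18, without two
    consecutive letters of norm 5, is automatically a Hurwitz expansion: adding
    a point of the fundamental domain to a letter of norm at least 9 leaves the
    modulus at least 5/2, so the inverse has modulus at most 2/5, and a letter
    of norm 5 tolerates a perturbation of that size.  It remains to find such
    words with denominator [m] up to a unit, which is done by folding: writing
    [-w^r] for the negated reversal of [w],
    - [w, x, -w^r] has denominator [x q^2] up to sign, where [q] is that of [w];
    - if [x] is a unit, which is not an allowed digit, the middle of the folded
      word is contracted: the last letter [a] of [w] followed by [x] and [-a]
      becomes [a + t] followed by [a - t] up to sign, with [t] a unit.
    With [x = -2 ± i] this passes from exponent [k] to [2k + 1], and with a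
    unit from [k] to [2k].  Folding repeats the first letter of [w] at the end
    up to sign, so only the extreme letters of the words for [k = 3, 4, 5] must
    allow [a ± t] as digits.  Exponents 1 and 2 are treated by hand. *)

Import Order.TTheory GRing.Theory Num.Theory.

Local Open Scope ring_scope.
Local Open Scope complex_scope.

Section HurwitzWords.
Variable R : realType.
Implicit Types (a b c t w x z : R[i]) (s : seq R[i]) (v : R[i] * R[i]).

Local Notation Re := complex.Re.
Local Notation Im := complex.Im.

(** * Arithmetic of Gaussian integers *)

Definition nsq z : R := Re z ^+ 2 + Im z ^+ 2.

Lemma nsqN z : nsq (- z) = nsq z.
Proof. by case: z => p q; rewrite /nsq /=; ring. Qed.

Lemma gauss_intD x z : gauss_int x -> gauss_int z -> gauss_int (x + z).
Proof.
case: x z => [p q] [r s] /andP[/= h1 h2] /andP[/= h3 h4].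
by apply/andP; split; rewrite /= rpredD.
Qed.

Lemma gauss_intN z : gauss_int (- z) = gauss_int z.
Proof. by case: z => p q; rewrite /gauss_int /= !rpredN. Qed.

Lemma gauss_intM x z : gauss_int x -> gauss_int z -> gauss_int (x * z).
Proof.
case: x z => [p q] [r s] /andP[/= h1 h2] /andP[/= h3 h4].
by apply/andP; split=> /=; rewrite ?rpredB ?rpredD ?rpredM.
Qed.

Lemma gauss_int0 : gauss_int (0 : R[i]).
Proof. by rewrite /gauss_int /= rpred0. Qed.

Lemma gauss_int1 : gauss_int (1 : R[i]).
Proof. by rewrite /gauss_int /= rpred0 rpred1. Qed.

Lemma gauss_round_add a w :
  gauss_int a -> fundamental_domain w -> gauss_round (a + w) = a.
Proof.
case: a w => [p q] [r s] /andP[/= /intrP[m ->] /intrP[n ->]].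
move=> /andP[/= /andP[h1 h2] /andP[h3 h4]]; rewrite /gauss_round /=.
rewrite (@floor_def _ _ m) ?(@floor_def _ _ n) //.
  by apply/andP; split; rewrite ?intrD; lra.
by apply/andP; split; rewrite ?intrD; lra.
Qed.

(** * Words that the Gauss map reads back letter by letter *)

Definition hcf_val s : R[i] := foldr (fun a w => (a + w)^-1) 0 s.

(** Each clause serves one step of the Gauss map: the value of the tail is the fractional part, so
    rounding returns [a], and the nonvanishing clause rules out the convention [0^-1 = 0]. The bound
    18 is (3 sqrt 2)^2. *)
Fixpoint admissible s : bool :=
  if s is a :: s' then
    [&& gauss_int a, nsq a <= 18, fundamental_domain (hcf_val s'),
        a + hcf_val s' != 0 & admissible s']
  else true.

Lemma admissible_drop n s : admissible s -> admissible (drop n s).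
Proof. by elim: s n => [|a s IH] [|n] //= /and5P[_ _ _ _ /IH]. Qed.

Lemma gauss_map_hcf_val s : admissible s ->
  gauss_map (hcf_val s) = hcf_val (behead s).
Proof.
case: s => [_|a s /= /and5P[ga _ fs n0 _]]; first by rewrite /gauss_map eqxx.
by rewrite /gauss_map invr_eq0 (negbTE n0) invrK gauss_round_add // addrC addKr.
Qed.

Lemma iter_gauss_map_hcf_val n s : admissible s ->
  iter n (@gauss_map R) (hcf_val s) = hcf_val (drop n s).
Proof.
move=> ads; elim: n => [|n IH]; first by rewrite drop0.
by rewrite iterS IH gauss_map_hcf_val ?admissible_drop // -drop1 drop_drop.
Qed.

Lemma hcf_length_le s : admissible s -> (hcf_length (hcf_val s) <= size s)%N.
Proof.
move=> ads; rewrite /hcf_length; case: pselect => // e.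
case: ex_minnP => n _; apply.
by rewrite iter_gauss_map_hcf_val // drop_size.
Qed.

Lemma hcf_K_hcf_val_le s : admissible s ->
  hcf_K (hcf_val s) <= 3 * Num.sqrt 2.
Proof.
move=> ads; rewrite /hcf_K big_nat.
apply: bigmax_le => [|n]; first by rewrite mulr_ge0 ?sqrtr_ge0.
case: n => // n /andP[_]; rewrite ltnS => ltn.
(* Digits are indexed from 1, so digit [n.+1] is the head of [drop n s]. *)
have {ltn} /(drop_nth 0) en := leq_trans ltn (hcf_length_le _ ads).
rewrite /hcf_digit [n.+1.-1]/= iter_gauss_map_hcf_val //.
have := admissible_drop n _ ads; rewrite {}en.
move: (nth _ _ _) (drop _ _) => a r /and5P[ga na fr _ _].
rewrite [hcf_val _]/= invrK gauss_round_add //.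
have -> : 3 * Num.sqrt 2 = Num.sqrt (18 : R).
  rewrite (_ : 18 = 3 ^+ 2 * 2); last by ring.
  by rewrite sqrtrM ?exprn_ge0 // sqrtr_sqr ger0_norm.
by case: a na {ga} => p q na; rewrite /= ler_wsqrtr.
Qed.

(** * Continuants and coprimality *)

(* [cf_act [:: a_1; ...; a_n]] is multiplication of the column (v.1, v.2) by
   the product of the matrices [[0, 1], [1, a_i]]. *)
Definition cf_step a v : R[i] * R[i] := (v.2, a * v.2 + v.1).
Definition cf_act s v : R[i] * R[i] := foldr cf_step v s.
Definition cf_num s : R[i] := (cf_act s (0, 1)).1.
Definition cf_den s : R[i] := (cf_act s (0, 1)).2.

Lemma cf_num_cons a s : cf_num (a :: s) = cf_den s.
Proof. by []. Qed.

Lemma cf_den_cons a s : cf_den (a :: s) = a * cf_den s + cf_num s.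
Proof. by []. Qed.

Lemma hcf_val_cf s : admissible s ->
  cf_den s != 0 /\ hcf_val s = cf_num s / cf_den s.
Proof.
elim: s => [_|a s IH /= /and5P[_ _ _ n0 /IH[d0 es]]].
  by rewrite /cf_den /cf_num /= oner_eq0 mul0r.
have e : cf_den (a :: s) = cf_den s * (a + hcf_val s).
  by rewrite cf_den_cons es mulrDr [_ * a]mulrC mulrCA divff // mulr1.
rewrite e; split; first by rewrite mulf_neq0.
by rewrite cf_num_cons invfM mulrA divff // mul1r.
Qed.

Lemma gauss_int_cf s : all (@gauss_int R) s ->
  gauss_int (cf_num s) /\ gauss_int (cf_den s).
Proof.
elim: s => [_|a s IH /= /andP[ga /IH[gp gq]]].
  by rewrite /cf_num /cf_den /= gauss_int0 gauss_int1.
by split=> //; rewrite cf_den_cons gauss_intD ?gauss_intM.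
Qed.

(** The matrices [[0, 1], [1, a]] are invertible over the Gaussian integers: prefixing [a] turns the
    coefficients (c, d) into (d - a c, c). *)
Lemma cf_bezout s : all (@gauss_int R) s ->
  exists c d, [/\ gauss_int c, gauss_int d
                & c * cf_num s + d * cf_den s = 1].
Proof.
elim: s => [_|a s IH /= /andP[ga /IH[c [d [gc gd e]]]]].
  exists 0, 1; split; rewrite ?gauss_int0 ?gauss_int1 //.
  by rewrite /cf_num /cf_den /= mulr0 add0r mulr1.
exists (d - a * c), c; split=> //.
  by rewrite gauss_intD // gauss_intN gauss_intM.
by rewrite cf_num_cons cf_den_cons -e; ring.
Qed.

Lemma admissible_gauss_int s : admissible s -> all (@gauss_int R) s.
Proof. by elim: s => //= a s IH /and5P[-> _ _ _ /IH]. Qed.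

(** The last clause excludes 0, whose inverse is 0 by convention. *)
Definition gauss_unit t : Prop := gauss_int t /\ gauss_int t^-1 /\ t != 0.

(** The unit moves to the numerator, [cf_num s / t], so that the fraction is the value of the word;
    [cf_bezout] gives coprimality. *)
Lemma hcf_word_solution m s t : admissible s -> fundamental_domain (hcf_val s) ->
    gauss_unit t -> cf_den s = t * m ->
  exists a, [/\ gauss_int a, gauss_is_gcd a m 1, fundamental_domain (a / m)
              & hcf_K (a / m) <= 3 * Num.sqrt 2].
Proof.
move=> ads fs [gt [gt' t0]] es.
have gs := admissible_gauss_int _ ads.
have [gp gq] := gauss_int_cf _ gs.
have [c [d [gc gd bez]]] := cf_bezout _ gs.
have [_ ev] := hcf_val_cf _ ads.
have ez : cf_num s / t / m = hcf_val s by rewrite ev es invfM mulrA.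
have em : m = cf_den s / t by rewrite es mulrAC divff // mul1r.
exists (cf_num s / t); rewrite ez; split=> //; first by rewrite gauss_intM.
- split; first exact: gauss_int1.
  + by exists (cf_num s / t); rewrite ?gauss_intM ?mul1r.
  + by exists m; rewrite ?mul1r // em gauss_intM.
  move=> e ge [q1 g1 e1] [q2 g2 e2].
  exists (t * (c * q1 + d * q2)); first by rewrite gauss_intM ?gauss_intD ?gauss_intM.
  rewrite -bez (_ : cf_num s = t * (e * q1)); last by rewrite -e1 mulrC divfK.
  by rewrite es e2; ring.
- exact: hcf_K_hcf_val_le.
Qed.

(** * Denominators of concatenated, reversed and folded words *)

Lemma cf_act_cat s1 s2 v : cf_act (s1 ++ s2) v = cf_act s1 (cf_act s2 v).
Proof. by rewrite /cf_act foldr_cat. Qed.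

Definition dot v v' : R[i] := v.1 * v'.1 + v.2 * v'.2.

(* The matrices [[0, 1], [1, a]] are symmetric. *)
Lemma cf_act_dot s v v' : dot (cf_act s v) v' = dot v (cf_act (rev s) v').
Proof.
elim: s v v' => [//|a s IH] v v'; rewrite rev_cons -cats1 cf_act_cat -IH.
by case: v' => p q; rewrite /dot /=; ring.
Qed.

(** The denominator is the lower right entry of a product of symmetric matrices, and transposition
    reverses the product. *)
Lemma cf_den_rev s : cf_den (rev s) = cf_den s.
Proof.
rewrite /cf_den; have := cf_act_dot s (0, 1) (0, 1).
by rewrite /dot /= !mul0r !mulr0 !add0r mulr1 mul1r => ->.
Qed.

Lemma cf_den_cat s1 s2 :
  cf_den (s1 ++ s2) =
  cf_num (rev s1) * cf_num s2 + cf_den (rev s1) * cf_den s2.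
Proof.
have := cf_act_dot (rev s1) (0, 1) (cf_act s2 (0, 1)).
rewrite revK -cf_act_cat /dot mul0r add0r mul1r => h.
by rewrite [LHS]/cf_den -h.
Qed.

(** With D = diag(1, -1), the matrix of [- a] is minus the conjugate by D of the matrix of [a]. *)
Lemma cf_opp s :
  cf_num (map -%R s) = (-1) ^+ (size s).+1 * cf_num s /\
  cf_den (map -%R s) = (-1) ^+ size s * cf_den s.
Proof.
elim: s => [|a s [IHn IHd]]; first by rewrite /cf_num /cf_den /= mulr0 expr0 mul1r.
rewrite /= !cf_num_cons !cf_den_cons IHn IHd !exprS.
by split; ring.
Qed.

(** With p and q the numerator and denominator of [rev s], the two terms in p q have opposite signs
    and cancel. *)
Lemma cf_den_fold x s : cf_den (s ++ x :: map -%R (rev s)) =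
  (-1) ^+ size s * x * cf_den s ^+ 2.
Proof.
rewrite cf_den_cat cf_num_cons cf_den_cons.
have [-> ->] := cf_opp (rev s).
by rewrite size_rev cf_den_rev exprS; ring.
Qed.

Lemma cf_den_rcons s a : cf_den (rcons s a) = a * cf_den (rev s) + cf_num (rev s).
Proof. by rewrite -[LHS]cf_den_rev rev_rcons cf_den_cons. Qed.

(** With p and q as for [rev s], the left side is (a q + p + t q)(a q + p - t q) + q^2, so
    [t ^+ 2 = 1] leaves a square. *)
Lemma cf_den_split1 t a s : t ^+ 2 = 1 ->
  cf_den (s ++ [:: a + t, a - t & rev s]) = cf_den (rcons s a) ^+ 2.
Proof.
move=> t1; rewrite cf_den_cat cf_den_rcons !(cf_num_cons, cf_den_cons).
by move: (cf_num _) (cf_den _) => p q; ring: t1.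
Qed.

(** Negating the second half reverses the sign of q^2 relative to the product, which calls for
    [t ^+ 2 = -1]. *)
Lemma cf_den_splitN1 t a s : t ^+ 2 = -1 ->
  cf_den (s ++ [:: a + t, - (a - t) & map -%R (rev s)]) =
  (-1) ^+ (size s).+1 * cf_den (rcons s a) ^+ 2.
Proof.
move=> t1; rewrite cf_den_cat cf_den_rcons !(cf_num_cons, cf_den_cons).
have [-> ->] := cf_opp (rev s); rewrite size_rev exprS.
by move: (cf_num _) (cf_den _) (_ ^+ size _) => p q e; ring: t1.
Qed.

(** * Digits and estimates for their inverses *)

Definition big_digit a : bool := gauss_int a && (9 <= nsq a <= 18).

Definition digit a : bool := big_digit a || (gauss_int a && (nsq a == 5)).

Definition compatible a b : bool := big_digit a || big_digit b.

Definition good_word s : bool := all digit s && sorted compatible s.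

(** Two integer coordinates of absolute value at most 2 give norm at most 8. *)
Lemma big_digitP a : big_digit a ->
  [\/ Re a <= - 3, 3 <= Re a, Im a <= - 3 | 3 <= Im a].
Proof.
case: a => p q /andP[/andP[/= /intrP[m ->] /intrP[n ->]] /andP[h _]].
move: h; rewrite /nsq /= -!rmorphXn -rmorphD /= (ler_int R 9) => h.
have : [\/ m <= - 3, 3 <= m, n <= - 3 | 3 <= n].
  have [h1|h1] := lerP m (- 3); first by constructor 1.
  have [h2|h2] := lerP 3 m; first by constructor 2.
  have [h3|h3] := lerP n (- 3); first by constructor 3.
  have [h4|h4] := lerP 3 n; first by constructor 4.
  by exfalso; nia.
by rewrite -(ler_int R m) -(ler_int R 3) -(ler_int R n) -(ler_int R 3 n).
Qed.

Lemma small_digitP a : gauss_int a -> nsq a = 5 ->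
  (Re a ^+ 2 = 4 /\ Im a ^+ 2 = 1) \/ (Re a ^+ 2 = 1 /\ Im a ^+ 2 = 4).
Proof.
case: a => p q /andP[/= /intrP[m ->] /intrP[n ->]].
rewrite /nsq /= -!rmorphXn -rmorphD /= => /eqP; rewrite (eqr_int R _ 5) => /eqP h.
have [[-> ->]|[-> ->]] : (m ^+ 2 = 4 /\ n ^+ 2 = 1) \/ (m ^+ 2 = 1 /\ n ^+ 2 = 4).
  have hm : - 2 <= m <= 2 by nia.
  have hn : - 2 <= n <= 2 by nia.
  have : m = -2 \/ m = -1 \/ m = 0 \/ m = 1 \/ m = 2 by lia.
  by move=> [|[|[|[|]]]] e; move: h; rewrite e; nia.
- by left.
- by right.
Qed.

Lemma inv_big_digit a w : big_digit a -> fundamental_domain w ->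
  a + w != 0 /\ nsq (a + w)^-1 <= 4 / 25.
Proof.
move=> /big_digitP; case: a w => [p q] [r s] /= ba /andP[/= /andP[h1 h2] /andP[h3 h4]].
have h : 25 / 4 <= (p + r) ^+ 2 + (q + s) ^+ 2.
  have sqp (x : R) : 5 / 2 <= x -> 25 / 4 <= x ^+ 2 by nra.
  have sqn (x : R) : x <= - (5 / 2) -> 25 / 4 <= x ^+ 2 by nra.
  have [hp hq] := (sqr_ge0 (p + r), sqr_ge0 (q + s)).
  case: ba => ba.
  - by have := sqn (p + r); lra.
  - by have := sqp (p + r); lra.
  - by have := sqn (q + s); lra.
  - by have := sqp (q + s); lra.
split.
  rewrite eq_complex /=; apply/negP => /andP[/eqP e1 /eqP e2].
  by move: h; rewrite e1 e2; lra.
rewrite /nsq /=; move: (p + r) (q + s) h => x y h.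
have d0 : x ^+ 2 + y ^+ 2 != 0 by apply/eqP => e; move: h; rewrite e; lra.
rewrite (_ : _ + _ = (x ^+ 2 + y ^+ 2)^-1); last by field.
by rewrite -[leRHS]invrK lef_pV2 ?posrE; lra.
Qed.

(** Inversion maps the lines bounding the domain to the unit circles centred at ±1 and ±i; the
    hypotheses place x + iy outside these four discs. *)
Lemma fundamental_domain_inv (x y : R) :
  2 * x < x ^+ 2 + y ^+ 2 -> - 2 * x < x ^+ 2 + y ^+ 2 ->
  2 * y < x ^+ 2 + y ^+ 2 -> - 2 * y < x ^+ 2 + y ^+ 2 ->
  fundamental_domain (x +i* y)^-1.
Proof.
move=> h1 h2 h3 h4; rewrite /fundamental_domain /=.
set d := x ^+ 2 + y ^+ 2 in h1 h2 h3 h4 *.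
have d0 : 0 < d by lra.
have db (z : R) : 2 * z < d -> - 2 * z < d -> (- 2^-1 < z / d) && (z / d < 2^-1).
  by move=> k1 k2; rewrite ltr_pdivlMr // ltr_pdivrMr //; apply/andP; split; lra.
have /andP[k1 k2] := db x h1 h2; have /andP[k3 k4] := db y h3 h4.
by apply/andP; split; apply/andP; split; lra.
Qed.

Lemma fundamental_domain_small z : nsq z <= 4 / 25 -> fundamental_domain z.
Proof.
case: z => x y; rewrite /nsq /= => h.
have [hx hy] := (sqr_ge0 x, sqr_ge0 y).
by apply/andP; split; apply/andP; split=> /=; nra.
Qed.

Lemma inv_small_digit a w : gauss_int a -> nsq a = 5 -> nsq w <= 4 / 25 ->
  a + w != 0 /\ fundamental_domain (a + w)^-1.
Proof.
move=> ga na hw; have := small_digitP _ ga na; case: a w {ga} na hw => [p q] [r s].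
rewrite /nsq /= => na hw pq.
(* This says |w + e1 + i e2| > 1, which holds since sqrt 2 - 2/5 > 1. Subtracting from a digit of
   norm 5 the nearest disc centre leaves ±1 ± i. *)
have corner (e1 e2 : R) : e1 ^+ 2 = 1 -> e2 ^+ 2 = 1 ->
    0 < 1 + 2 * (e1 * r + e2 * s) + r ^+ 2 + s ^+ 2.
  move=> k1 k2; set S := e1 * r + e2 * s.
  (* [S >= -57/100] because [S^2 <= 2 (r^2 + s^2) <= 8/25], and
     [1 + 2 S + S^2 / 2 > 0] from there on. *)
  have := sqr_ge0 (e1 * r - e2 * s).
  have -> : (e1 * r - e2 * s) ^+ 2 = 2 * (r ^+ 2 + s ^+ 2) - S ^+ 2.
    by rewrite /S; ring: k1 k2.
  move=> hS; have S1 : - (57 / 100) <= S by rewrite leNgt; apply/negP => S1; nra.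
  (* The two constants add up to 4, and the product, S^2 + 4 S + 1.9551, is below 2 (1 + 2 S + S^2 /
     2). *)
  have : 0 <= (S + 57 / 100) * (S + 343 / 100) by apply: mulr_ge0; lra.
  by nra.
have := corner 1 1; have := corner 1 (-1).
have := corner (-1) 1; have := corner (-1) (-1).
rewrite !sqrrN !expr1n !mulN1r !mul1r => /(_ erefl erefl) c1 /(_ erefl erefl) c2.
move=> /(_ erefl erefl) c3 /(_ erefl erefl) c4.
have [r2 s2] := (sqr_ge0 r, sqr_ge0 s).
have r1 : - (2 / 5) <= r <= 2 / 5 by apply/andP; split; nra.
have s1 : - (2 / 5) <= s <= 2 / 5 by apply/andP; split; nra.
have pm (x c : R) : x ^+ 2 = c ^+ 2 -> x = c \/ x = - c.
  by move=> /eqP; rewrite eqf_sqr => /orP[/eqP|/eqP]; [left|right].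
have s4 : 4 = 2 ^+ 2 :> R by ring.
have s1' : 1 = 1 ^+ 2 :> R by ring.
rewrite {}s4 {}s1' in pq.
split; last first.
  by case: pq => -[/pm[]-> /pm[]->]; apply: fundamental_domain_inv; lra.
rewrite eq_complex /=; apply/negP => /andP[/eqP e1 /eqP e2].
by case: pq => -[/pm[] e /pm[] e']; move: e1 e2; rewrite e e'; lra.
Qed.

(** * Admissibility and closure properties of good words *)

Lemma good_word_cons a s : good_word (a :: s) -> digit a /\ good_word s.
Proof.
by case/andP=> /= /andP[da ds] /path_sorted ss; split=> //; apply/andP.
Qed.

(** The third clause carries the induction: a letter of norm 5 is last or precedes a big one, so its
    tail has modulus at most 2/5. *)
Lemma good_word_admissible s : good_word s ->
  [/\ admissible s, fundamental_domain (hcf_val s)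
    & big_digit (head 0 s) || nilp s -> nsq (hcf_val s) <= 4 / 25].
Proof.
elim: s => [_|a s IH gas].
  have h : nsq (0 : R[i]) <= 4 / 25 by rewrite /nsq /=; lra.
  by split=> //; apply: fundamental_domain_small.
have [da /IH[ads fs bs]] := good_word_cons _ _ gas.
have [ba|nba] := boolP (big_digit a).
  have [n0 le] := inv_big_digit _ _ ba fs.
  split=> //=; last exact: fundamental_domain_small.
  by case/andP: ba => -> /andP[_ ->]; rewrite fs n0 ads.
move: da; rewrite /digit (negbTE nba) => /= /andP[ga /eqP na].
have [|n0 f] := inv_small_digit a (hcf_val s) ga na.
  apply: bs; case/andP: gas => _; case: (s) => [|b s'] /=; first by rewrite orbT.
  by rewrite /compatible (negbTE nba) => /andP[/= ->].
split=> //=; rewrite ?orbF ?(negbTE nba) // ga fs n0 ads na.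
by apply/andP; split=> //; lra.
Qed.

Lemma big_digitN a : big_digit (- a) = big_digit a.
Proof. by rewrite /big_digit gauss_intN nsqN. Qed.

Lemma digitN a : digit (- a) = digit a.
Proof. by rewrite /digit big_digitN gauss_intN nsqN. Qed.

Lemma good_word_opp s : good_word (map -%R s) = good_word s.
Proof.
rewrite /good_word all_map sorted_map; congr andb.
  by apply: eq_all => a; rewrite /= digitN.
by apply: eq_sorted => a b; rewrite /= /compatible !big_digitN.
Qed.

Lemma good_word_rev s : good_word (rev s) = good_word s.
Proof.
rewrite /good_word all_rev rev_sorted; congr andb.
by apply: eq_sorted => a b; rewrite /compatible orbC.
Qed.

Lemma good_word_catl s1 s2 : good_word (s1 ++ s2) -> good_word s1.
Proof. by rewrite /good_word all_cat => /andP[/andP[-> _] /cat_sorted2[-> _]]. Qed.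

Lemma good_word_cat_big s1 b s2 : good_word s1 -> big_digit b ->
  good_word (b :: s2) -> good_word (s1 ++ b :: s2).
Proof.
move=> /andP[d1 o1] bb /andP[d2 o2]; rewrite /good_word all_cat d1 d2 /=.
case: s1 o1 {d1} => //= a s1 o1; rewrite cat_path o1 /=.
by rewrite {1}/compatible bb orbT.
Qed.

Lemma good_word_cons_big b s : big_digit b -> good_word s -> good_word (b :: s).
Proof.
move=> bb /andP[d o]; rewrite /good_word /= {1}/digit bb d /=.
by case: s o {d} => //= a s ->; rewrite /compatible bb.
Qed.

Lemma good_word_cons_digit x b s : digit x -> big_digit b ->
  good_word (b :: s) -> good_word [:: x, b & s].
Proof.
by move=> dx bb /andP[d o]; rewrite /good_word /= dx /compatible bb orbT; apply/andP.
Qed.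

(** * Folding *)

Definition splittable a : Prop :=
  big_digit a /\ exists t, [/\ (t ^+ 2 == 1) || (t ^+ 2 == -1),
                              big_digit (a + t) & big_digit (a - t)].

Lemma splittableN a : splittable a -> splittable (- a).
Proof.
move=> [ba [t [ht h1 h2]]]; split; first by rewrite big_digitN.
exists t; split=> //; last by rewrite -opprD big_digitN.
by rewrite -[t]opprK -opprD big_digitN.
Qed.

Lemma gauss_unit1 : gauss_unit 1.
Proof. by split; rewrite ?invr1 ?oner_neq0 ?gauss_int1. Qed.

Lemma gauss_unitM t t' : gauss_unit t -> gauss_unit t' -> gauss_unit (t * t').
Proof.
move=> [g1 [g2 n0]] [g3 [g4 n0']]; split; first exact: gauss_intM.
by split; [rewrite invfM; exact: gauss_intM|rewrite mulf_neq0].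
Qed.

Lemma gauss_unitX t n : gauss_unit t -> gauss_unit (t ^+ n).
Proof.
move=> ut; elim: n => [|n IH]; first by rewrite expr0; exact: gauss_unit1.
by rewrite exprS; exact: gauss_unitM.
Qed.

Lemma gauss_unitN1 : gauss_unit (-1).
Proof.
by split; rewrite ?invrN1 ?oppr_eq0 ?oner_neq0 ?gauss_intN ?gauss_int1.
Qed.

(** Folding splits the last letter, and makes the first one, up to sign, the new last letter; it
    also introduces signs, absorbed by the unit. *)
Definition foldable m : Prop := exists a s b t,
  [/\ splittable a, splittable b, good_word (a :: rcons s b), gauss_unit t
    & cf_den (a :: rcons s b) = t * m].

(** The letter [x] stands between [b] and [- b], both big, so no two letters of norm 5 meet. *)
Lemma foldable_mul_sqr x m : gauss_int x -> nsq x = 5 ->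
  foldable m -> foldable (x * m ^+ 2).
Proof.
move=> gx nx [a [s [b [t [sa sb gs ut e]]]]].
have dx : digit x by rewrite /digit gx nx eqxx orbT.
have ew : a :: rcons (rcons s b ++ x :: - b :: map -%R (rev s)) (- a) =
          (a :: rcons s b) ++ x :: map -%R (rev (a :: rcons s b)).
  by rewrite rev_cons rev_rcons /= map_rcons -!rcons_cons -rcons_cat.
exists a, (rcons s b ++ x :: - b :: map -%R (rev s)), (- a).
exists ((-1) ^+ size (a :: rcons s b) * t ^+ 2).
rewrite ew cf_den_fold e; split=> //.
- exact: splittableN.
- have [bb _] := sb.
  have gr : good_word (map -%R (rev (a :: rcons s b))).
    by rewrite good_word_opp good_word_rev.
  rewrite -rcons_cons cat_rcons; apply: good_word_cat_big => //.
    by apply: good_word_catl [:: b] _; rewrite cats1 rcons_cons.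
  apply: good_word_cons_big => //.
  move: gr; rewrite -rcons_cons rev_rcons /=.
  by apply: good_word_cons_digit; rewrite ?big_digitN.
- by apply: gauss_unitM; apply: gauss_unitX => //; exact: gauss_unitN1.
- by ring.
Qed.

(** The square of the unit splitting [b] decides whether the second half is the reversal or its
    negative. *)
Lemma foldable_sqr m : foldable m -> foldable (m ^+ 2).
Proof.
move=> [a [s [b [t [sa [bb [u [hu b1 b2]]] gs ut e]]]]].
have gas : good_word (a :: s).
  by apply: good_word_catl [:: b] _; rewrite cats1 rcons_cons.
have grs : good_word (rev (a :: s)) by rewrite good_word_rev.
case/orP: hu => /eqP hu.
- have ew : a :: rcons (s ++ [:: b + u, b - u & rev s]) a =
            (a :: s) ++ [:: b + u, b - u & rev (a :: s)].
    by rewrite rev_cons -!rcons_cons -rcons_cat.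
  exists a, (s ++ [:: b + u, b - u & rev s]), a, (t ^+ 2).
  rewrite ew cf_den_split1 // rcons_cons e; split=> //.
  + apply: good_word_cat_big => //; apply: good_word_cons_big => //.
    exact: good_word_cons_big.
  + exact: gauss_unitX.
  + by ring.
- have ew : a :: rcons (s ++ [:: b + u, - (b - u) & map -%R (rev s)]) (- a) =
            (a :: s) ++ [:: b + u, - (b - u) & map -%R (rev (a :: s))].
    by rewrite rev_cons map_rcons -!rcons_cons -rcons_cat.
  exists a, (s ++ [:: b + u, - (b - u) & map -%R (rev s)]), (- a).
  exists ((-1) ^+ (size (a :: s)).+1 * t ^+ 2).
  rewrite ew cf_den_splitN1 // rcons_cons e; split=> //.
  + exact: splittableN.
  + apply: good_word_cat_big => //; apply: good_word_cons_big => //.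
    by apply: good_word_cons_big; rewrite ?big_digitN ?good_word_opp.
  + by apply: gauss_unitM; apply: gauss_unitX => //; exact: gauss_unitN1.
  + by ring.
Qed.

(** * Base words and induction on the exponent *)

Local Ltac gint :=
  by rewrite /gauss_int /=
     ?(rpredN, rpredB, rpredD, rpredM, rpred_nat, rpred0, rpred1).

Local Ltac big :=
  apply/andP; split; [gint|rewrite /nsq /=; apply/andP; split; lra].

Local Ltac complex_eq :=
  apply/eqP; rewrite eq_complex; apply/andP; split; apply/eqP; rewrite /=; ring.

Lemma splittable_re a : big_digit a -> big_digit (a + 1) -> big_digit (a - 1) ->
  splittable a.
Proof. by move=> ba b1 b2; split=> //; exists 1; rewrite expr1n eqxx. Qed.

Lemma splittable_im a : big_digit a -> big_digit (a + 'i) -> big_digit (a - 'i) ->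
  splittable a.
Proof. by move=> ba b1 b2; split=> //; exists 'i; rewrite sqr_i eqxx orbT. Qed.

Lemma foldable_exp345 (e : R) : e = 1 \/ e = -1 ->
  [/\ foldable ((-2 +i* e) ^+ 3), foldable ((-2 +i* e) ^+ 4)
    & foldable ((-2 +i* e) ^+ 5)].
Proof.
move=> he; split.
(* Here (3 + 2ei)(1 + 3ei) + 1 = -2 + 11ei = (-2 + ei)^3; the two signs of [e] are conjugate. *)
- exists (3 +i* (2 * e)), [::], (1 +i* (3 * e)), 1; split.
  + by apply: splittable_im; case: he => ->; big.
  + by apply: splittable_re; case: he => ->; big.
  + by do 2 (apply: good_word_cons_big; first by case: he => ->; big).
  + exact: gauss_unit1.
  + by rewrite /cf_den /=; case: he => ->; complex_eq.
- exists 3, [:: 1 +i* (-2 * e)], (2 +i* (-3 * e)), 1; split.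
  + by apply: splittable_im; big.
  + by apply: splittable_re; case: he => ->; big.
  + apply: good_word_cons_big; first by big.
    have bl : big_digit (2 +i* (-3 * e)) by case: he => ->; big.
    apply: good_word_cons_digit => //; last exact: good_word_cons_big.
    apply/orP; right; apply/andP; split; first by case: he => ->; gint.
    by apply/eqP; rewrite /nsq /=; case: he => ->; ring.
  + exact: gauss_unit1.
  + by rewrite /cf_den /=; case: he => ->; complex_eq.
- exists 4, [:: (-1) +i* (4 * e)], (-2 +i* (3 * e)), (-1); split.
  + by apply: splittable_im; big.
  + by apply: splittable_re; case: he => ->; big.
  + apply: good_word_cons_big; first by big.
    by do 2 (apply: good_word_cons_big; first by case: he => ->; big).
  + exact: gauss_unitN1.
  + by rewrite /cf_den /=; case: he => ->; complex_eq.
Qed.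

Lemma foldable_exp (e : R) k : e = 1 \/ e = -1 -> (3 <= k)%N ->
  foldable ((-2 +i* e) ^+ k).
Proof.
move=> he; elim/ltn_ind: k => k IH k3.
have [f3 f4 f5] := foldable_exp345 _ he.
have [->//|n3] := eqVneq k 3; have [->//|n4] := eqVneq k 4.
have [->//|n5] := eqVneq k 5.
(* From 6 on the half is at least 3, so 3, 4 and 5 are the base cases. *)
have fh : foldable ((-2 +i* e) ^+ k./2) by apply: IH; lia.
rewrite -(odd_double_half k) -muln2 exprD exprM; case: (odd k); last first.
  by rewrite expr0 mul1r; exact: foldable_sqr.
rewrite expr1; apply: foldable_mul_sqr => //; first by case: he => ->; gint.
by rewrite /nsq /=; case: he => ->; ring.
Qed.

Lemma foldable_solution m : foldable m ->
  exists a, [/\ gauss_int a, gauss_is_gcd a m 1, fundamental_domain (a / m)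
              & hcf_K (a / m) <= 3 * Num.sqrt 2].
Proof.
move=> [a [s [b [t [_ _ gs ut e]]]]].
have [ads fs _] := good_word_admissible _ gs.
exact: hcf_word_solution ads fs ut e.
Qed.

Lemma solution_exp1 (e : R) : e = 1 \/ e = -1 ->
  exists a, [/\ gauss_int a, gauss_is_gcd a (-2 +i* e) 1,
                fundamental_domain (a / (-2 +i* e))
              & hcf_K (a / (-2 +i* e)) <= 3 * Num.sqrt 2].
Proof.
move=> he; have gs : good_word [:: -2 +i* e].
  rewrite /good_word /= !andbT; apply/orP; right; apply/andP.
  split; first by case: he => ->; gint.
  by apply/eqP; rewrite /nsq /=; case: he => ->; ring.
have [ads fs _] := good_word_admissible _ gs.
apply: hcf_word_solution ads fs gauss_unit1 _.
by rewrite /cf_den /= mulr1 addr0 mul1r.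
Qed.

(** The word [1 + ei, 3] has denominator 4 + 3ei = ei (-2 + ei)^2. Its first digit has norm 2,
    outside the alphabet of good words, so admissibility is checked directly. *)
Lemma solution_exp2 (e : R) : e = 1 \/ e = -1 ->
  exists a, [/\ gauss_int a, gauss_is_gcd a ((-2 +i* e) ^+ 2) 1,
                fundamental_domain (a / (-2 +i* e) ^+ 2)
              & hcf_K (a / (-2 +i* e) ^+ 2) <= 3 * Num.sqrt 2].
Proof.
move=> he.
have g3 : good_word [:: 3] by apply: good_word_cons_big => //; big.
have [ad3 f3 _] := good_word_admissible _ g3.
have es : (1 +i* e) + hcf_val [:: 3] = (4 / 3) +i* e.
  rewrite /hcf_val /= addr0; apply/eqP; rewrite eq_complex.
  by apply/andP; split; apply/eqP; rewrite /=; field.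
have ut : gauss_unit (0 +i* e).
  have h : (0 +i* e) * (0 +i* - e) = 1 by case: he => ->; complex_eq.
  have n0 : (0 +i* e) != 0.
    by apply/eqP => n0; move: h; rewrite n0 mul0r => /eqP; rewrite eq_sym oner_eq0.
  split; first by case: he => ->; gint.
  by split=> //; rewrite -[_^-1]mulr1 -h mulKf //; case: he => ->; gint.
apply: (@hcf_word_solution _ [:: 1 +i* e; 3] _ _ _ ut).
- apply/and5P; split=> //.
  + by case: he => ->; gint.
  + by rewrite /nsq /=; case: he => ->; lra.
  + by rewrite es eq_complex /=; apply/negP => /andP[/eqP e0 _]; lra.
- rewrite -[hcf_val _]/((1 +i* e) + hcf_val [:: 3])^-1 es.
  by apply: fundamental_domain_inv; case: he => ->; lra.
- by rewrite /cf_den /=; case: he => ->; complex_eq.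
Qed.

End HurwitzWords.

Theorem theorem5p2 (R : realType) (plus : bool) (k : nat) (hk : (1 <= k)%N)
    (m : R[i]) (hm : m = (if plus then - 2 + 'i%C else - 2 - 'i%C) ^+ k) :
  exists a : R[i],
    [/\ gauss_int a,
        gauss_is_gcd a m 1,
        fundamental_domain (a / m)
      & hcf_K (a / m) <= 3 * Num.sqrt 2].
Proof.
pose e : R := if plus then 1 else -1.
have he : e = 1 \/ e = -1 by rewrite /e; case: plus {e hm}; [left|right].
have {}hm : m = (-2 +i* e) ^+ k.
  rewrite hm /e; congr (_ ^+ _); case: plus {e he hm};
    by apply/eqP; rewrite eq_complex /=; apply/andP; split; apply/eqP; ring.
rewrite {}hm; case: k hk => [|[|[|k]]] // _.
- exact: solution_exp1.
- exact: solution_exp2.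
- by apply: foldable_solution; exact: foldable_exp.
Qed.
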